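(* Let $r\ge0$ be an integer, let $W_0,\dots,W_{r+1}$ be nonnegative numbers such that $\sum_{k=0}^{r+1}W_k=1$, and assume that there are numbers $A_{j+1/2}^n,B_{j+1/2}^n,E_{j+1/2}^n,F_{j+1/2}^n\in\mathbb{R}$ (for each $j\in\mathbb{Z}$, $n\in\mathbb{N}_0$) satisfying $$A_{j+1/2}^n,\,B_{j+1/2}^n,\,E_{j+1/2}^n,\,F_{j+1/2}^n\ge0,\qquad A_{j+1/2}^n+B_{j+1/2}^n+E_{j+1/2}^n+F_{j+1/2}^n\le1\qquad\text{for all }n,j.$$ Then solutions $(u_j^n)_{j\in\mathbb{Z},n\in\mathbb{N}_0}$ computed with the scheme $$u_j^{n+1}=u_j^n+\bigl(A_{j+1/2}^n(u_{j+1}^n-u_j^n)-B_{j-1/2}^n(u_j^n-u_{j-1}^n)\bigr)W_0+\sum_{k=1}^{r+1}\sum_{l=1}^k\bigl(E_{j+l-1/2}^n(u_{j+l}^n-u_{j+l-1}^n)-F_{j-l+1/2}^n(u_{j-l+1}^n-u_{j-l}^n)\bigr)\frac1kW_k$$ are TVD, i.e. they satisfy $$\sum_j|u_{j+1}^{n+1}-u_j^{n+1}|\le\sum_j|u_{j+1}^n-u_j^n|\qquad\text{for all }n.$$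
   Context: All quantities are real; $j$ ranges over $\mathbb{Z}$ and $n$ over $\mathbb{N}_0=\{0,1,2,\dots\}$; the sums over $j$ are over $\mathbb{Z}$ with values in $[0,\infty]$. *)

(* Defs.v *)
From mathcomp Require Import all_boot all_order all_algebra.
From mathcomp Require Import all_classical all_reals all_analysis.

Set Implicit Arguments.
Unset Strict Implicit.
Unset Printing Implicit Defensive.

Import Order.TTheory GRing.Theory Num.Theory.

Local Open Scope classical_set_scope.
Local Open Scope ring_scope.

(* A doubly indexed family x_j^n is written [x n j].  A family indexed by
   half-integers is indexed by the integer on the left: [A n j] stands for
   A_{j+1/2}^n, hence A_{j-1/2}^n is [A n (j - 1)]. *)

Section TVD.
Variable R : realType.
Implicit Types (A B E F u : nat -> int -> R) (W : nat -> R).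

(* Only W 0, ..., W r.+1 are used.  E_{j+l-1/2} is [E n (j + l - 1)] and
   F_{j-l+1/2} is [F n (j - l)]. *)
Definition scheme_solution (r : nat) W A B E F u : Prop :=
  forall (n : nat) (j : int),
    u n.+1 j = u n j
      + (A n j * (u n (j + 1) - u n j)
         - B n (j - 1) * (u n j - u n (j - 1))) * W 0%N
      + \sum_(1 <= k < r.+2) \sum_(1 <= l < k.+1)
          (E n (j + l%:Z - 1) * (u n (j + l%:Z) - u n (j + l%:Z - 1))
           - F n (j - l%:Z) * (u n (j - l%:Z + 1) - u n (j - l%:Z)))
          * (1 / k%:R) * W k.

Definition seqTV (v : int -> R) : \bar R :=
  (\esum_(j in [set: int]) `|v (j + 1) - v j|%:E)%E.

Definition TVD u : Prop := forall n : nat, (seqTV (u n.+1) <= seqTV (u n))%E.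

End TVD.

(* Main.v *)
Require Import Defs.
From mathcomp Require Import all_boot all_order all_algebra.
From mathcomp Require Import all_classical all_reals all_analysis.
From mathcomp Require Import ring lra.

Import Order.TTheory GRing.Theory Num.Theory.

Local Open Scope ring_scope.

(** Let d_j = u_{j+1}^n - u_j^n be the increments at time n.  Each inner sum
    over l in the scheme telescopes when it is differenced in j, so the
    increments at time n+1 are
      sum_k ((W_k - p_k(j) - q_k(j)) d_j + p_k(j+m_k) d_{j+m_k}
             + q_k(j-m_k) d_{j-m_k}),
    where m_k = max(k,1), with p_k = W_k E/k and q_k = W_k F/k for k > 0, and
    p_0 = W_0 A and q_0 = W_0 B
    ([increment_sum_fluxes], with [scheme_solution_fluxes]).  In other words,
    the k-th stencil is responsible for the part W_k d_j of every increment: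
    it moves p_k(j) d_j by m_k cells to the left, q_k(j) d_j by m_k cells to
    the right, and leaves the rest in place.  All coefficients are nonnegative
    because A, B, E, F >= 0 and A + B + E + F <= 1 ([moved_share_le]), so the
    triangle inequality bounds |d_j^{n+1}| by the same transport applied to
    |d_j|; and a transport conserves the total mass over Z
    ([esum_transport]).  Summing over k and using sum_k W_k = 1 gives
    the claim ([le_seqTV_transport]).

    All sums are sums of nonnegative terms that are rearranged and never
    subtracted, so the argument holds verbatim when the total variation at
    time n is infinite. *)

Section Transport.
Context {R : realType}.

Lemma esum_int_shift (a : int -> \bar R) (m : int) :
  \esum_(j in [set: int]) a (j + m) = \esum_(j in [set: int]) a j.
Proof.
rewrite [RHS](reindex_esum [set: int] [set: int] (fun j => j + m)) //.
rewrite setTT_bijective; exists (fun j => j - m) => j /=; [exact: addrK|exact: subrK].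
Qed.

(** Conservation of mass.  The left-hand side collects at j what stays there
    and what arrives from j + m and j - m; shifting the last two sums back
    regroups the terms by the place that they leave. *)
Lemma esum_transport (w : R) (p q a : int -> R) (m : int) :
    (forall j, 0 <= a j) -> (forall j, 0 <= p j) -> (forall j, 0 <= q j) ->
    (forall j, p j + q j <= w) ->
  \esum_(j in [set: int]) ((w - p j - q j) * a j + p (j + m) * a (j + m)
                           + q (j - m) * a (j - m))%:E
  = \esum_(j in [set: int]) (w * a j)%:E.
Proof.
move=> a0 p0 q0 pqw.
have stay0 j : 0 <= (w - p j - q j) * a j.
  by apply: mulr_ge0 => //; have := pqw j; lra.
have pa0 j : 0 <= p j * a j by exact: mulr_ge0.
have qa0 j : 0 <= q j * a j by exact: mulr_ge0.
under eq_esum do rewrite 2!EFinD.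
rewrite !esumD; try by move=> j _; rewrite ?adde_ge0 // lee_fin.
rewrite (esum_int_shift (fun j => (p j * a j)%:E)).
rewrite (esum_int_shift (fun j => (q j * a j)%:E)).
rewrite -!esumD; try by move=> j _; rewrite ?adde_ge0 // lee_fin.
by apply: eq_esum => j _; rewrite -!EFinD; congr (_%:E); ring.
Qed.

(** A superposition of transports with weights of total 1 does not increase
    the total variation: signed increments may cancel, their absolute values
    are conserved. *)
Lemma le_seqTV_transport (v v' : int -> R) (N : nat) (w : nat -> R)
    (p q : nat -> int -> R) (m : nat -> int) :
    \sum_(k < N) w k = 1 ->
    (forall (k : 'I_N) j, 0 <= p k j) -> (forall (k : 'I_N) j, 0 <= q k j) ->
    (forall (k : 'I_N) j, p k j + q k j <= w k) ->
    (forall j, v' (j + 1) - v' j =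
       \sum_(k < N) ((w k - p k j - q k j) * (v (j + 1) - v j)
         + p k (j + m k) * (v (j + m k + 1) - v (j + m k))
         + q k (j - m k) * (v (j - m k + 1) - v (j - m k)))) ->
  (seqTV v' <= seqTV v)%E.
Proof.
move=> w1 p0 q0 pqw dv'.
pose a j := `|v (j + 1) - v j|.
have a0 j : 0 <= a j by exact: normr_ge0.
have stay0 (k : 'I_N) j : 0 <= w k - p k j - q k j by have := pqw k j; lra.
pose moved k j := (w k - p k j - q k j) * a j + p k (j + m k) * a (j + m k)
                  + q k (j - m k) * a (j - m k).
have moved0 (k : 'I_N) j : 0 <= moved k j by rewrite !addr_ge0 ?mulr_ge0.
have w0 (k : 'I_N) : 0 <= w k.
  by apply: le_trans (pqw k 0); rewrite addr_ge0.
have -> : seqTV v = \esum_(j in [set: int]) \sum_(k < N) (moved k j)%:E.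
  rewrite esum_sum; last by move=> j k _ _; rewrite lee_fin.
  rewrite (eq_bigr (fun k : 'I_N => \esum_(j in [set: int]) (w k * a j)%:E));
    last by move=> k _; exact: esum_transport.
  rewrite -esum_sum; last by move=> j k _ _; rewrite lee_fin mulr_ge0.
  by apply: eq_esum => j _; rewrite sumEFin -mulr_suml w1 mul1r.
apply: le_esum => j _; rewrite sumEFin lee_fin dv'.
apply: le_trans (ler_norm_sum _ _ _) _; apply: ler_sum => k _.
apply: le_trans (ler_normD _ _) _; rewrite normrM (ger0_norm (q0 _ _)) lerD2r.
apply: le_trans (ler_normD _ _) _.
by rewrite !normrM (ger0_norm (p0 _ _)) (ger0_norm (stay0 _ _)).
Qed.

End Transport.

Section Scheme.
Context {R : realType}.

(** Raising j by 1 shifts the two sums over l by one place in opposite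
    directions, so that in the difference only their end terms remain. *)
Lemma increment_sum_fluxes (f g : int -> R) (m : nat) (j : int) :
  \sum_(1 <= l < m.+1) (f (j + 1 + l%:Z - 1) - g (j + 1 - l%:Z))
  - \sum_(1 <= l < m.+1) (f (j + l%:Z - 1) - g (j - l%:Z))
  = f (j + m%:Z) - f j - g j + g (j - m%:Z).
Proof.
elim: m => [|m IHm].
  by rewrite !big_geq // addr0 subr0; ring.
rewrite !(@big_nat_recr _ _ _ m.+1) //= opprD addrACA IHm.
have -> : j + 1 + m.+1%:Z - 1 = j + m.+1%:Z by ring.
have -> : j + m.+1%:Z - 1 = j + m%:Z by rewrite intS; ring.
have -> : j + 1 - m.+1%:Z = j - m%:Z by rewrite intS; ring.
by ring.
Qed.

(** The share of an increment that the k-th stencil moves to one side: c0 is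
    the coefficient of the three-point part and c that of the wide stencils. *)
Definition moved_share (W : nat -> R) (c0 c : int -> R) (k : nat) (j : int) :=
  if k is 0%N then W 0%N * c0 j else W k * (c j / k%:R).

Lemma moved_share_ge0 W c0 c k j :
  0 <= W k -> 0 <= c0 j -> 0 <= c j -> 0 <= moved_share W c0 c k j.
Proof. by case: k => [|k] *; rewrite mulr_ge0 ?divr_ge0. Qed.

(** No stencil moves more than its part of an increment.  For the wide stencils
    this survives the division by k because k >= 1. *)
Lemma moved_share_le W a b e f k j : 0 <= W k ->
    [/\ 0 <= a j, 0 <= b j, 0 <= e j & 0 <= f j] ->
    a j + b j + e j + f j <= 1 ->
  moved_share W a e k j + moved_share W b f k j <= W k.
Proof.
case: k => [|k] W0 [a0 b0 e0 f0] le1; rewrite -mulrDr ler_piMr //; first by lra.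
rewrite -mulrDl ler_pdivrMr ?ltr0n // mul1r.
by apply: (@le_trans _ _ 1); [lra | rewrite ler1n].
Qed.

(** The three-point part is the sum over l of a stencil of half-width 1, like
    the one for k = 1; whence the range maxn k 1. *)
Lemma scheme_solution_fluxes {r : nat} {W : nat -> R}
    {A B E F u : nat -> int -> R} (n : nat) (j : int) :
  scheme_solution r W A B E F u ->
  let f k i := moved_share W (A n) (E n) k i * (u n (i + 1) - u n i) in
  let g k i := moved_share W (B n) (F n) k i * (u n (i + 1) - u n i) in
  u n.+1 j = u n j + \sum_(k < r.+2) \sum_(1 <= l < (maxn k 1).+1)
                       (f k (j + l%:Z - 1) - g k (j - l%:Z)).
Proof.
move=> u_sol f g; rewrite u_sol big_ord_recl /= big_nat1 big_add1 /= big_mkord.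
rewrite -addrA; congr (_ + (_ + _)).
  by rewrite /f /g /= addrK subrK; ring.
apply: eq_bigr => k _; rewrite /bump /= add1n maxnSS maxn0.
by apply: eq_bigr => l _; rewrite /f /g /= subrK; ring.
Qed.

End Scheme.

Theorem lemma3p3 (R : realType) (r : nat) (W : nat -> R)
    (A B E F : nat -> int -> R) (u : nat -> int -> R)
    (W_ge0 : forall k : nat, (k <= r.+1)%N -> 0 <= W k)
    (W_sum1 : \sum_(0 <= k < r.+2) W k = 1)
    (ABEF_ge0 : forall (n : nat) (j : int),
      [/\ 0 <= A n j, 0 <= B n j, 0 <= E n j & 0 <= F n j])
    (ABEF_le1 : forall (n : nat) (j : int),
      A n j + B n j + E n j + F n j <= 1)
    (u_sol : scheme_solution r W A B E F u) :
  TVD u.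
Proof.
move=> n.
have W0 (k : 'I_r.+2) : 0 <= W k by apply: W_ge0; rewrite -ltnS.
have W1 : \sum_(k < r.+2) W k = 1 by rewrite -W_sum1 big_mkord.
apply: (@le_seqTV_transport _ _ _ r.+2 W (moved_share W (A n) (E n))
          (moved_share W (B n) (F n)) (fun k => (maxn k 1)%:Z)) => //.
- by move=> k j; have [? ? ? ?] := ABEF_ge0 n j; exact: moved_share_ge0.
- by move=> k j; have [? ? ? ?] := ABEF_ge0 n j; exact: moved_share_ge0.
- by move=> k j; exact: moved_share_le.
move=> j; rewrite !(scheme_solution_fluxes _ _ u_sol) opprD addrACA -sumrB.
rewrite -[X in X + _ = _]mul1r -W1 mulr_suml -big_split /=.
apply: eq_bigr => k _.
rewrite (increment_sum_fluxes
  (fun i => moved_share W (A n) (E n) k i * (u n (i + 1) - u n i))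
  (fun i => moved_share W (B n) (F n) k i * (u n (i + 1) - u n i))).
by ring.
Qed.
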